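(* Let $X$ be a strictly monotone real sequence space with a 1-unconditional basis $\{e_i\}_{i=1}^d$, where $d=\dim X$, $3\le d\le\infty$. Suppose that either (a) $X$ is one-$p$-convex for some $2<p<\infty$, or (b) $X$ is one-$q$-concave for some $1<q<2$, and $X$ is smooth at each basic vector $e_i$. Then any 1-complemented subspace $F$ of finite codimension $n$ in $X$ contains all but at most $2n$ of the basic vectors $e_i$ of $X$.
   Context: All spaces are real. A sequence space is a Banach space $X$ with a 1-unconditional basis $\{e_i\}_{i=1}^d$ ($d\le\infty$; if $d=\infty$ the index set is $\mathbb{N}$): a (Schauder) basis such that $\|\sum_i \varepsilon_i a_i e_i\|=\|\sum_i a_i e_i\|$ for all $\sum_i a_ie_i\in X$ and all signs $\varepsilon_i=\pm1$. Elements $x=\sum_i x_i e_i$ are identified with their coordinate sequences; order, absolute value and powers are taken coordinatewise. $X$ is strictly monotone if $|x|\le|y|$ coordinatewise and $|x|\ne|y|$ imply $\|x\|<\|y\|$. $X$ is one-$p$-convex ($1\le p<\infty$) if for every finite choice $x_1,\dots,x_m\in X$, $\|(\sum_{i=1}^m|x_i|^p)^{1/p}\|\le(\sum_{i=1}^m\|x_i\|^p)^{1/p}$. $X$ is one-$q$-concave ($1\le q<\infty$) if for every finite choice $x_1,\dots,x_m\in X$, $\|(\sum_{i=1}^m|x_i|^q)^{1/q}\|\ge(\sum_{i=1}^m\|x_i\|^q)^{1/q}$. $X$ is smooth at $x\neq0$ if there is exactly one norm-one functional $f\in X^*$ with $f(x)=\|x\|$. A subspace $F$ is 1-complemented in $X$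 if there is a linear projection of norm at most one from $X$ onto $F$. *)

(* Defs.v *)
From HB Require Import structures.
From mathcomp Require Export all_boot all_order all_algebra.
From mathcomp Require Export all_classical all_reals all_analysis.
Export Order.TTheory GRing.Theory Num.Theory.
Export numFieldNormedType.Exports.
Set Implicit Arguments.
Unset Strict Implicit.
Unset Printing Implicit Defensive.
Local Open Scope classical_set_scope.
Local Open Scope ring_scope.

(* Bases are families [e : nat -> X] restricted to the indices in [index_set d],
   where [d = Some m] stands for dimension m and [d = None] for d = oo. Indices
   start at 0. Values of [e] outside [index_set d] play no role, since
   coefficient families are required to vanish there. *)
Definition index_set (d : option nat) : set nat :=
  if d is Some m then `I_m else setT.

Definition expansion (R : realType) (X : normedModType R) (d : option nat)
    (e : nat -> X) (a : nat -> R) (x : X) : Prop :=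
  (forall i, ~ index_set d i -> a i = 0) /\
  series (fun i => a i *: e i) @ \oo --> x.

Definition schauder_basis (R : realType) (X : normedModType R)
    (d : option nat) (e : nat -> X) : Prop :=
  forall x : X, exists! a : nat -> R, expansion d e a x.

Definition one_unconditional_basis (R : realType) (X : normedModType R)
    (d : option nat) (e : nat -> X) : Prop :=
  schauder_basis d e /\
  forall (a : nat -> R) (x : X) (eps : nat -> bool), expansion d e a x ->
    exists2 y : X, expansion d e (fun i => (-1) ^+ eps i * a i) y & `|y| = `|x|.

(* The coordinate sequence of [x]; the default 0 is never reached when [e] is a
   Schauder basis. *)
Definition coord (R : realType) (X : normedModType R) (d : option nat)
    (e : nat -> X) (x : X) : nat -> R :=
  xget (fun=> 0) [set a : nat -> R | expansion d e a x].

Definition strictly_monotone (R : realType) (X : normedModType R)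
    (d : option nat) (e : nat -> X) : Prop :=
  forall x y : X,
    (forall i, `|coord d e x i| <= `|coord d e y i|) ->
    (exists i, `|coord d e x i| != `|coord d e y i|) ->
    `|x| < `|y|.

(* [is_power_sum d e p x y] says that y is the element
   (\sum_i |x_i|^p)^(1/p), computed coordinatewise. Over a 1-unconditional basis
   such a y exists and is unique, its coordinates being dominated by those of
   \sum_i |x_i|. *)
Definition is_power_sum (R : realType) (X : normedModType R)
    (d : option nat) (e : nat -> X) (p : R) (m : nat) (x : 'I_m -> X) (y : X) :
    Prop :=
  forall j, coord d e y j =
    (\sum_(i < m) `|coord d e (x i) j| `^ p) `^ p^-1.

Definition one_convex (R : realType) (X : normedModType R)
    (d : option nat) (e : nat -> X) (p : R) : Prop :=
  forall (m : nat) (x : 'I_m -> X) (y : X), is_power_sum d e p x y ->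
    `|y| <= (\sum_(i < m) `|x i| `^ p) `^ p^-1.

Definition one_concave (R : realType) (X : normedModType R)
    (d : option nat) (e : nat -> X) (q : R) : Prop :=
  forall (m : nat) (x : 'I_m -> X) (y : X), is_power_sum d e q x y ->
    (\sum_(i < m) `|x i| `^ q) `^ q^-1 <= `|y|.

(* [sup] is 0 on unbounded sets, hence the explicit continuity in
   [norming_functional]. *)
Definition dual_norm (R : realType) (X : normedModType R) (f : X -> R) : R :=
  sup [set `|f y| | y in [set y : X | `|y| <= 1]].

Definition norming_functional (R : realType) (X : normedModType R)
    (x : X) (f : X -> R) : Prop :=
  [/\ scalar f, continuous f, dual_norm f = 1 & f x = `|x|].

Definition smooth_at (R : realType) (X : normedModType R) (x : X) : Prop :=
  x != 0 /\ exists! f : X -> R, norming_functional x f.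

Definition one_complemented (R : realType) (X : normedModType R)
    (F : {pred X}) : Prop :=
  exists P : {linear X -> X},
    [/\ forall x, P x \in F, forall x, x \in F -> P x = x
      & forall x, `|P x| <= `|x|].

(* The classes of v_0, ..., v_(n-1) form a basis of X / F. *)
Definition has_codim (R : realType) (X : normedModType R)
    (F : {pred X}) (n : nat) : Prop :=
  exists v : 'I_n -> X, forall x : X,
    exists! c : 'rV[R]_n, x - \sum_(i < n) c ord0 i *: v i \in F.

(* Main.v *)
Require Import Defs.
From mathcomp Require Import zify ring lra.
Set Implicit Arguments.
Unset Strict Implicit.
Unset Printing Implicit Defensive.
Local Open Scope classical_set_scope.
Local Open Scope card_scope.
Local Open Scope ring_scope.

(* Let P be the contractive projection, q_ik the i-th coordinate of P e_k, and x
   a finitely supported element of F.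
   - If X is p-convex with p > 2 and x_i = 0, then |x + t P e_i| <= |x + t e_i|
     <= |x| + O(|t|^p), whereas p-convexity and strict monotonicity force growth of
     order t^2 as soon as P e_i meets the support of x. Hence P e_i is disjoint
     from x.
   - If X is q-concave with q < 2, x_i = 0 and x_k != 0, then |x + t e_k| grows
     at most quadratically (averaging over t and -t), while q-concavity makes
     |x + t P e_k| grow at least like |t q_ik|^q. Hence q_ik = 0.
   In both cases q_ik != 0 makes the i-th and k-th coordinates proportional on F,
   provided neither vanishes there.
   Strict monotonicity gives q_ii != 1 whenever e_i is not in F. Given 2n+1 such
   indices, let W be the elements of F supported on them, so dim W >= n+1. From
   x_i = \sum_k q_ik x_k and q_ii != 1, every coordinate which is nonzero on W is
   proportional to another one, so 2 dim W <= 2n+1, a contradiction. *)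

(** * Elementary inequalities for real powers *)

Section RealPowers.
Variable R : realType.
Implicit Types a b c p q s t x y C D : R.

Lemma powR_midpoint p x y : 1 <= p -> 0 <= x -> 0 <= y ->
  (2^-1 * x + 2^-1 * y) `^ p <= 2^-1 * x `^ p + 2^-1 * y `^ p.
Proof.
move=> p1 x0 y0; rewrite {2 4}(_ : 2^-1 = 1 - 2^-1 :> R); last by field.
by apply: (convex_powR p1 (Itv01 _ _)) => //=;
  rewrite ?inE/= ?in_itv/= ?andbT// ?invr_ge0// invf_le1 ?ler1n.
Qed.

Lemma powR_normX p a : p != 0 -> (`|a| `^ p) `^ (2 / p) = a ^+ 2.
Proof.
move=> p0; rewrite -powRrM mulrCA mulfV// mulr1 powR_mulrn// -normrX.
by rewrite ger0_norm ?sqr_ge0.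
Qed.

Lemma sqr_powR_half p a : (a ^+ 2) `^ (p / 2) = `|a| `^ p.
Proof.
rewrite -[a ^+ 2]ger0_norm ?sqr_ge0// normrX -powR_mulrn// -powRrM.
by rewrite mulrCA mulfV// mulr1.
Qed.

Lemma powR_sum_sqr p a b : a != 0 ->
  (a ^+ 2 + b ^+ 2) `^ (p / 2) = `|a| `^ p * (1 + b ^+ 2 / a ^+ 2) `^ (p / 2).
Proof.
move=> a0; rewrite -sqr_powR_half -powRM ?addr_ge0 ?divr_ge0 ?sqr_ge0//.
by congr (_ `^ _); field.
Qed.

(** Convexity of s^(p/2) at the points (a + b)^2 and (a - b)^2, whose mean is a^2 + b^2, followed by
    1 + r <= (1 + r)^(p/2). *)
Lemma powR_parallelogram_ge p a b : 2 <= p -> a != 0 ->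
  (1 + b ^+ 2 / a ^+ 2) * `|a| `^ p <=
  2^-1 * `|a + b| `^ p + 2^-1 * `|a - b| `^ p.
Proof.
move=> p2 a0; rewrite -(sqr_powR_half p (a + b)) -(sqr_powR_half p (a - b)).
apply: le_trans (powR_midpoint _ (sqr_ge0 _) (sqr_ge0 _)); last first.
  by rewrite ler_pdivlMr// mul1r.
have -> : 2^-1 * (a + b) ^+ 2 + 2^-1 * (a - b) ^+ 2 = a ^+ 2 + b ^+ 2 by field.
rewrite powR_sum_sqr// mulrC ler_wpM2l ?powR_ge0//.
have h1 : 1 <= 1 + b ^+ 2 / a ^+ 2 by rewrite lerDl divr_ge0 ?sqr_ge0.
by rewrite -{1}[1 + _]powRr1 ?(le_trans _ h1)// ler_powR// ler_pdivlMr// mul1r.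
Qed.

(** The reverse estimate, since s^(q/2) is concave; the concavity is derived from the convexity of
    its inverse s^(2/q). *)
Lemma powR_parallelogram_le q a b : 0 < q <= 2 -> a != 0 ->
  2^-1 * `|a + b| `^ q + 2^-1 * `|a - b| `^ q <=
  (1 + b ^+ 2 / a ^+ 2) * `|a| `^ q.
Proof.
move=> /andP[q0 q2] a0.
have h1 : 1 <= 1 + b ^+ 2 / a ^+ 2 by rewrite lerDl divr_ge0 ?sqr_ge0.
have q2' : q / 2 <= 1 by rewrite ler_pdivrMr// mul1r.
apply: (@le_trans _ _ ((a ^+ 2 + b ^+ 2) `^ (q / 2))); last first.
  rewrite powR_sum_sqr// mulrC ler_wpM2r ?powR_ge0//.
  by rewrite -{2}[1 + _]powRr1 ?(le_trans _ h1)// ler_powR.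
have -> : a ^+ 2 + b ^+ 2 = 2^-1 * (a + b) ^+ 2 + 2^-1 * (a - b) ^+ 2 by field.
set m := _ + _.
have m0 : 0 <= m by rewrite addr_ge0// mulr_ge0 ?powR_ge0.
have qn0 : q != 0 by rewrite gt_eqF.
have -> : m = (m `^ (2 / q)) `^ (q / 2).
  by rewrite -powRrM mulrA divfK// mulfV// powRr1.
rewrite ge0_ler_powR ?divr_ge0 ?(ltW q0)// ?nnegrE ?powR_ge0//.
  by rewrite addr_ge0// mulr_ge0 ?sqr_ge0.
apply: le_trans (powR_midpoint _ (powR_ge0 _ _) (powR_ge0 _ _)) _.
  by rewrite ler_pdivlMr// mul1r.
by rewrite !powR_normX.
Qed.

(** Triangle inequality for 2u = (u + v) + (u - v), then convexity of s^p. *)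
Lemma powR_norm_midpoint (V : normedZmodType R) p (u v : V) : 1 <= p ->
  `|u| `^ p <= 2^-1 * `|u + v| `^ p + 2^-1 * `|u - v| `^ p.
Proof.
move=> p1; apply: le_trans (powR_midpoint p1 (normr_ge0 _) (normr_ge0 _)).
rewrite ge0_ler_powR ?nnegrE ?(le_trans ler01 p1) ?addr_ge0 ?mulr_ge0//.
have : `|u *+ 2| <= `|u + v| + `|u - v|.
  by apply: le_trans (ler_normD _ _); rewrite addrACA subrr addr0 mulr2n.
rewrite normrMn -mulr_natr; lra.
Qed.

(** As t tends to 0, a term of order t^p cannot be dominated by one of higher order t^q. This turns
    growth estimates into contradictions. *)
Lemma powR_small_coef p q c C : 0 < p < q ->
  (forall t, 0 < t -> c * t `^ p <= C * t `^ q) -> c <= 0.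
Proof.
move=> /andP[p0 pq] h; rewrite leNgt; apply/negP => c0.
have C0 : 0 < C.
  by have := h 1 ltr01; rewrite !powR1 !mulr1; apply: lt_le_trans.
have qp : 0 < q - p by rewrite subr_gt0.
(* Chosen so that t^(q-p) = c / (2C), hence C t^q = (c/2) t^p < c t^p. *)
pose t := (c / (2 * C)) `^ (q - p)^-1.
have t0 : 0 < t by rewrite powR_gt0// divr_gt0// mulr_gt0.
have := h _ t0.
have -> : t `^ q = t `^ p * (c / (2 * C)).
  rewrite -{1}(subrK p q) addrC powRD; last by rewrite (gt_eqF t0) implybT.
  by rewrite /t -[X in _ * X]powRrM mulVf ?gt_eqF// powRr1// divr_ge0 ?mulr_ge0// ltW.
rewrite mulrCA [c * _]mulrC (ler_pM2l (powR_gt0 p t0)).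
have -> : C * (c / (2 * C)) = c / 2 by field; rewrite gt_eqF.
by move: c0; lra.
Qed.

Lemma powRVK p (s : R) : 0 < p -> 0 <= s -> (s `^ p^-1) `^ p = s.
Proof. by move=> p0 s0; rewrite -powRrM mulVf ?gt_eqF// powRr1. Qed.

Lemma powR_le_inv p (s t : R) : 0 < p -> 0 <= s -> 0 <= t ->
  s `^ p <= t `^ p -> s <= t.
Proof.
move=> p0 s0 t0; rewrite !leNgt; apply: contra => st.
by rewrite gt0_ltr_powR// nnegrE.
Qed.

Lemma norm_powR_scale (V : normedModType R) p c (v : V) : 0 < p -> 0 <= c ->
  `|c `^ p^-1 *: v| `^ p = c * `|v| `^ p.
Proof.
move=> p0 c0; rewrite normrZ (ger0_norm (powR_ge0 _ _)) powRM ?powR_ge0//.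
by rewrite powRVK.
Qed.

End RealPowers.

(** * Linear algebra: the rank of a matrix whose nonzero rows have parallel partners *)

Lemma row_free_row_neq (K : fieldType) (m n : nat) (A : 'M[K]_(m, n))
    (i j : 'I_m) (c : K) :
  row_free A -> row i A = c *: row j A -> i = j.
Proof.
move=> fA; rewrite !rowE scalemxAl => /(row_free_inj fA)/rowP/(_ i).
by rewrite !mxE !eqxx/=; case: eqP => //= _ /eqP; rewrite mulr0 oner_eq0.
Qed.

Lemma row_free_row_neq0 (K : fieldType) (m n : nat) (A : 'M[K]_(m, n))
    (i : 'I_m) : row_free A -> row i A != 0.
Proof.
move=> fA; apply/eqP; rewrite rowE -[RHS](mul0mx _ A).
move=> /(row_free_inj fA)/rowP/(_ i)/eqP.
by rewrite !mxE !eqxx/= oner_eq0.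
Qed.

(** A maximal free family of rows [f] is matched with partners [g]. By freeness no partner lies in
    the family and no two members share one, so [f] and [g] together inject 2 rank A indices into
    N. *)
Lemma rank_le_half_of_parallel (K : fieldType) (N m : nat) (A : 'M[K]_(N, m)) :
  (forall i, row i A != 0 ->
     exists k, i != k /\ exists c, row i A = c *: row k A) ->
  (2 * \rank A <= N)%N.
Proof.
move=> hA; set f := maxrankfun A.
have fA : row_free (rowsub f A) by exact: maxrowsub_free.
have rf j : row j (rowsub f A) = row (f j) A.
  by apply/rowP => k; rewrite !mxE.
have ex j : exists k, f j != k /\ exists c, row (f j) A = c *: row k A.
  by apply: hA; rewrite -rf row_free_row_neq0.
have [g gP] := choice ex.
have gf j j' : g j <> f j'.
  move=> E; have [+ [c]] := gP j; rewrite E -!rf => + /(row_free_row_neq fA) jj'.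
  by rewrite jj' eqxx.
have gI : injective g.
  move=> j j' E; have [_ [c hc]] := gP j; have [_ [c' hc']] := gP j'.
  have c'0 : c' != 0.
    apply/eqP => c'0; have := row_free_row_neq0 j' fA.
    by rewrite rf hc' c'0 scale0r eqxx.
  apply: (@row_free_row_neq _ _ _ _ _ _ (c / c') fA).
  by rewrite !rf hc hc' E scalerA mulfVK.
pose h (s : 'I_(\rank A) + 'I_(\rank A)) :=
  match s with inl j => f j | inr j => g j end.
have hI : injective h.
  move=> [a|a] [b|b] /= E.
  - by rewrite (maxrankfun_inj E).
  - by case: (@gf b a).
  - by case: (@gf a b).
  - by rewrite (gI _ _ E).
by have := leq_card h hI; rewrite card_sum !card_ord mul2n addnn.
Qed.

(** * Coordinates, and monotonicity of the norm *)

Section SequenceSpace.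
Variables (R : realType) (X : normedModType R) (d : option nat) (e : nat -> X).
Hypothesis he : one_unconditional_basis d e.
Hypothesis hmono : strictly_monotone d e.
Implicit Types (x y z : X) (a b : nat -> R) (i j k N : nat) (p q : R).

Local Notation coord := (coord d e).

Lemma coordP x : expansion d e (coord x) x.
Proof.
have [a [aP _]] := he.1 x.
by have /= := @xgetPex _ (fun=> 0) [set b | expansion d e b x] (ex_intro _ a aP).
Qed.

Lemma expansion_coord x a : expansion d e a x -> coord x = a.
Proof.
move=> xa; have [b [_ bU]] := he.1 x.
by rewrite -(bU _ (coordP x)) -(bU _ xa).
Qed.

Lemma coord_out x i : ~ index_set d i -> coord x i = 0.
Proof. exact: (coordP x).1. Qed.

Lemma coord_inj x y : (forall i, coord x i = coord y i) -> x = y.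
Proof.
move=> /funext xy; have [_ +] := coordP x; have [_ +] := coordP y.
by rewrite xy => cy cx; apply: cvg_unique cx cy.
Qed.

Lemma coordPZ (c : R) x y i : coord (c *: x + y) i = c * coord x i + coord y i.
Proof.
rewrite (@expansion_coord _ (fun i => c * coord x i + coord y i))//.
have [ox cx] := coordP x; have [oy cy] := coordP y.
split=> [j oj|]; first by rewrite ox// oy// mulr0 addr0.
rewrite (_ : series _ = (fun n => c *: series (fun i => coord x i *: e i) n +
    series (fun i => coord y i *: e i) n)).
  by apply: cvgD => //; apply: cvgZr.
apply/funext => n; rewrite /series/= scaler_sumr -big_split/=.
by apply: eq_bigr => j _; rewrite scalerDl scalerA.
Qed.

Lemma coord0 i : coord 0 i = 0.
Proof.
have := coordPZ 1 0 0 i; rewrite scale1r addr0 mul1r => /eqP.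
by rewrite -subr_eq subrr eq_sym => /eqP.
Qed.

Lemma coordZ (c : R) x i : coord (c *: x) i = c * coord x i.
Proof. by rewrite -[_ *: _]addr0 coordPZ coord0 addr0. Qed.

Lemma coordD x y i : coord (x + y) i = coord x i + coord y i.
Proof. by rewrite -[x]scale1r coordPZ mul1r scale1r. Qed.

Lemma coord_sum (I : Type) (r : seq I) (f : I -> X) i :
  coord (\sum_(l <- r) f l) i = \sum_(l <- r) coord (f l) i.
Proof.
elim/big_ind2 : _ => [|x u y v <- <-|//]; [exact: coord0|exact: coordD].
Qed.

Lemma coord_ex N a : (forall i, ~ index_set d i -> a i = 0) ->
  (forall i, (N <= i)%N -> a i = 0) -> exists x, coord x = a.
Proof.
move=> oa Na; exists (\sum_(0 <= i < N) a i *: e i).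
apply: expansion_coord; split=> //.
apply: cvg_near_cst; exists N => // n /= Nn; rewrite /series/=.
rewrite (big_cat_nat _ Nn)//= [X in _ + X]big_nat [X in _ + X]big1 ?addr0// => i /andP[Ni _].
by rewrite Na// scale0r.
Qed.

Lemma coord_basis i j : index_set d i -> coord (e i) j = (j == i)%:R.
Proof.
move=> di; rewrite (@expansion_coord _ (fun j => (j == i)%:R))//; split=> [k|].
  by have [->|] := eqVneq k i.
apply: cvg_near_cst; exists i.+1 => // n /= ilt; rewrite /series/=.
rewrite (bigD1_seq i) ?mem_index_iota ?iota_uniq//= eqxx scale1r big1 ?addr0//.
by move=> k /negPf ->; rewrite scale0r.
Qed.

Lemma norm_eq_abs x y : (forall i, `|coord x i| = `|coord y i|) -> `|x| = `|y|.
Proof.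
(* Signs are flipped in y exactly where it differs from x; the resulting vector is x itself. *)
move=> xy; have [z zy <-] := he.2 _ _ (fun i => coord x i != coord y i) (coordP y).
congr (`|_|); apply: coord_inj => i; rewrite (expansion_coord zy).
have [->|/eqP xyi] := eqVneq; first by rewrite expr0 mul1r.
rewrite expr1 mulN1r; have := xy i => /eqP; rewrite eqr_norm2.
by case/orP => /eqP.
Qed.

Lemma norm_mono x y : (forall i, `|coord x i| <= `|coord y i|) -> `|x| <= `|y|.
Proof.
move=> xy; have [h|] := pselect (exists i, `|coord x i| != `|coord y i|).
  exact/ltW/hmono.
move=> /forallNP h; rewrite (@norm_eq_abs x y)// => i.
by apply/eqP; apply/negPn/negP/h.
Qed.

Definition supp_below N x := forall i, (N <= i)%N -> coord x i = 0.

Lemma supp_belowW N N' x : (N <= N')%N -> supp_below N x -> supp_below N' x.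
Proof. by move=> NN xN i Ni; apply/xN/(leq_trans NN). Qed.

Lemma supp_below_basis i : index_set d i -> supp_below i.+1 (e i).
Proof. by move=> di k ik; rewrite coord_basis// gtn_eqF. Qed.

Lemma supp_belowPZ N (c : R) x y :
  supp_below N x -> supp_below N y -> supp_below N (c *: x + y).
Proof. by move=> xN yN i Ni; rewrite coordPZ xN// yN// mulr0 addr0. Qed.

Lemma coord_restrict_ex N z x : supp_below N z ->
  exists y, forall j, coord y j = if coord z j == 0 then 0 else coord x j.
Proof.
move=> zN.
have [i di|i Ni|y yE] :=
  @coord_ex N (fun j => if coord z j == 0 then 0 else coord x j).
- by rewrite (coord_out x di); case: ifP.
- by rewrite zN// eqxx.
- by exists y => j; rewrite yE.
Qed.

Lemma coord_remove_ex N k x : supp_below N x ->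
  exists y, forall j, coord y j = if j == k then 0 else coord x j.
Proof.
move=> xN; have [i di|i Ni|y yE] := @coord_ex N (fun j => if j == k then 0 else coord x j).
- by rewrite (coord_out x di); case: ifP.
- by rewrite xN//; case: ifP.
- by exists y => j; rewrite yE.
Qed.

(** * Weighted forms of p-convexity and q-concavity *)

Lemma power_sum_ex N p (m : nat) (x : 'I_m -> X) : 0 < p ->
  (forall l, supp_below N (x l)) -> exists y, is_power_sum d e p x y.
Proof.
move=> p0 xN.
have [i di|i Ni|y yE] :=
  @coord_ex N (fun j => (\sum_(l < m) `|coord (x l) j| `^ p) `^ p^-1).
- rewrite big1 ?powR0 ?invr_eq0 ?gt_eqF// => l _.
  by rewrite coord_out// normr0 powR0 ?gt_eqF.
- rewrite big1 ?powR0 ?invr_eq0 ?gt_eqF// => l _.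
  by rewrite xN// normr0 powR0 ?gt_eqF.
- by exists y => j; rewrite yE.
Qed.

Lemma coord_powR_scale p (c : R) x j : 0 < p -> 0 <= c ->
  `|coord (c `^ p^-1 *: x) j| `^ p = c * `|coord x j| `^ p.
Proof.
move=> p0 c0; rewrite coordZ normrM (ger0_norm (powR_ge0 _ _)) powRM ?powR_ge0//.
by rewrite powRVK.
Qed.

Lemma coord_power_sum p (m : nat) (x : 'I_m -> X) y j : 0 < p ->
  is_power_sum d e p x y ->
  `|coord y j| `^ p = \sum_(l < m) `|coord (x l) j| `^ p.
Proof.
by move=> p0 ->; rewrite ger0_norm ?powR_ge0// powRVK// sumr_ge0.
Qed.

(** Each weight is absorbed by scaling x_l by c_l^(1/p), and monotonicity of the norm relaxes the
    coordinatewise equality to an inequality. *)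
Lemma one_convex_le p N (m : nat) (c : 'I_m -> R) (x : 'I_m -> X) z :
  0 < p -> one_convex d e p -> (forall l, 0 <= c l) -> supp_below N z ->
  (forall j, `|coord z j| `^ p <= \sum_(l < m) c l * `|coord (x l) j| `^ p) ->
  `|z| `^ p <= \sum_(l < m) c l * `|x l| `^ p.
Proof.
move=> p0 cvx c0 zN zx.
(* The x_l may have infinite support. Cutting them down to the support of z makes their power sum
   finitely supported, and the norms only decrease. *)
have [u uE] := choice (fun l => coord_restrict_ex (c l `^ p^-1 *: x l) zN).
have [l i Ni|y yP] := @power_sum_ex N p m u p0.
  by rewrite uE zN// eqxx.
have zy : `|z| <= `|y|.
  apply: norm_mono => j; apply: (powR_le_inv p0) => //.
  have [->|zj] := eqVneq (coord z j) 0; first by rewrite normr0 powR0 ?powR_ge0 ?gt_eqF.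
  rewrite (coord_power_sum _ p0 yP) (le_trans (zx j))//; apply: ler_sum => l _.
  by rewrite uE (negPf zj) coord_powR_scale.
apply: (@le_trans _ _ (`|y| `^ p)); first by rewrite ge0_ler_powR ?nnegrE ?(ltW p0).
have S0 : 0 <= \sum_(l < m) `|u l| `^ p by apply: sumr_ge0 => l _; exact: powR_ge0.
apply: (@le_trans _ _ (\sum_(l < m) `|u l| `^ p)).
  rewrite -(powRVK p0 S0) ge0_ler_powR ?nnegrE ?powR_ge0 ?(ltW p0)//.
  exact: cvx.
apply: ler_sum => l _; rewrite -norm_powR_scale// ge0_ler_powR ?nnegrE ?(ltW p0)//.
by apply: norm_mono => j; rewrite uE; case: ifP; rewrite ?normr0.
Qed.

Lemma one_concave_ge q N (m : nat) (c : 'I_m -> R) (x : 'I_m -> X) z :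
  0 < q -> one_concave d e q -> (forall l, 0 <= c l) ->
  (forall l, supp_below N (x l)) ->
  (forall j, \sum_(l < m) c l * `|coord (x l) j| `^ q <= `|coord z j| `^ q) ->
  \sum_(l < m) c l * `|x l| `^ q <= `|z| `^ q.
Proof.
move=> q0 ccv c0 xN xz; pose u l := c l `^ q^-1 *: x l.
have [l i Ni|y yP] := @power_sum_ex N q m u q0.
  by rewrite coordZ xN// mulr0.
apply: (@le_trans _ _ (`|y| `^ q)); last first.
  rewrite ge0_ler_powR ?nnegrE ?(ltW q0)//.
  apply: norm_mono => j; apply: (powR_le_inv q0) => //.
  rewrite (coord_power_sum _ q0 yP) (le_trans _ (xz j))//; apply: ler_sum => l _.
  by rewrite coord_powR_scale.
rewrite (eq_bigr (fun l => `|u l| `^ q)); last by move=> l _; rewrite norm_powR_scale.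
have S0 : 0 <= \sum_(l < m) `|u l| `^ q by apply: sumr_ge0 => l _; exact: powR_ge0.
rewrite -(powRVK q0 S0) ge0_ler_powR ?nnegrE ?powR_ge0 ?(ltW q0)//.
exact: ccv.
Qed.

(** * Coordinates of contractive images of basic vectors *)

Section Contraction.
Variable P : {linear X -> X}.
Hypothesis P_le : forall x, `|P x| <= `|x|.

(** Any further nonzero coordinate of P e_i would make its norm exceed that of e_i, by strict
    monotonicity. *)
Lemma contraction_fixes_basis i : index_set d i ->
  coord (P (e i)) i = 1 -> P (e i) = e i.
Proof.
move=> di Pi.
have le j : `|coord (e i) j| <= `|coord (P (e i)) j|.
  rewrite coord_basis//; have [->|_] := eqVneq j i; first by rewrite Pi.
  by rewrite normr0.
have [h|/forallNP h] := pselect (exists j, `|coord (e i) j| != `|coord (P (e i)) j|).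
  by have := hmono le h; rewrite ltNge P_le.
apply: coord_inj => j; have [->|ji] := eqVneq j i.
  by rewrite Pi coord_basis// eqxx.
have /negP/negPn/eqP := h j.
rewrite coord_basis// (negPf ji) normr0 => /esym/eqP.
by rewrite normr_eq0 => /eqP.
Qed.

Lemma convex_contraction_disjoint p N x i k :
  2 < p -> one_convex d e p -> P x = x -> supp_below N x -> index_set d i ->
  coord x i = 0 -> coord x k != 0 -> coord (P (e i)) k = 0.
Proof.
move=> p2 cvx Px xN di xi xk; apply: contrapT => /eqP wk.
have p0 : 0 < p by apply: lt_trans p2.
(* x' is x without its k-th coordinate; strict monotonicity makes the gap |x|^p - |x'|^p positive,
   and this gap times [rho] is the t^2 coefficient. *)
have [x' x'E] := coord_remove_ex k xN.
have x'x : `|x'| < `|x|.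
  apply: hmono; first by move=> j; rewrite x'E; case: ifP; rewrite ?normr0.
  by exists k; rewrite x'E eqxx normr0 eq_sym normr_eq0.
have D0 : 0 < `|x| `^ p - `|x'| `^ p.
  by rewrite subr_gt0 gt0_ltr_powR ?nnegrE.
pose rho := coord (P (e i)) k ^+ 2 / coord x k ^+ 2.
have rho0 : 0 < rho by rewrite divr_gt0// exprn_even_gt0.
suff : rho * (`|x| `^ p - `|x'| `^ p) <= 0 by rewrite leNgt mulr_gt0.
apply: (@powR_small_coef R 2 p _ (`|e i| `^ p)); first by rewrite p2 andbT.
move=> t t0; have two : t `^ 2 = t ^+ 2 by rewrite powR_mulrn// ltW.
(* x = P x gives x + s P e_i = P (x + s e_i), and x and e_i are disjoint, so p-convexity applies
   with weights 1 and t^p. *)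
have upper (s : R) : `|s| = t ->
    `|x + s *: P (e i)| `^ p <= `|x| `^ p + t `^ p * `|e i| `^ p.
  move=> st; apply: (@le_trans _ _ (`|x + s *: e i| `^ p)).
    by rewrite ge0_ler_powR ?nnegrE ?(ltW p0)// -{1}Px -linearZ -linearD.
  have zN : supp_below (maxn N i.+1) (x + s *: e i).
    rewrite addrC; apply: supp_belowPZ.
      exact: supp_belowW (leq_maxr _ _) (supp_below_basis di).
    exact: supp_belowW (leq_maxl _ _) xN.
  have := @one_convex_le p _ 2 (fun l => nth 0 [:: 1; t `^ p] l)
    (fun l => nth 0 [:: x; e i] l) _ p0 cvx _ zN.
  rewrite !big_ord_recl big_ord0/= addr0 mul1r; apply.
    by case=> [[|[|]]]//= _; exact: powR_ge0.
  move=> j; rewrite !big_ord_recl big_ord0/= addr0 mul1r coordD coordZ.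
  rewrite coord_basis//; have [->|_] := eqVneq j i.
    by rewrite xi add0r mulr1 st normr0 powR0 ?gt_eqF// add0r normr1 powR1 mulr1.
  by rewrite mulr0 addr0 normr0 powR0 ?gt_eqF// mulr0 addr0.
have r1 : 0 <= 1 + rho * t ^+ 2 by rewrite addr_ge0// mulr_ge0 ?sqr_ge0// ltW.
(* At coordinate k the parallelogram inequality gains the factor 1 + rho t^2. Elsewhere the midpoint
   inequality yields only the factor 1, and the term in x' supplies the rest. *)
have lower : (1 + rho * t ^+ 2) * `|x| `^ p <=
    2^-1 * `|x + t *: P (e i)| `^ p +
    (2^-1 * `|x + - t *: P (e i)| `^ p + rho * t ^+ 2 * `|x'| `^ p).
  have zN : supp_below N ((1 + rho * t ^+ 2) `^ p^-1 *: x).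
    by move=> j Nj; rewrite coordZ xN// mulr0.
  have := @one_convex_le p N 3 (fun l => nth 0 [:: 2^-1; 2^-1; rho * t ^+ 2] l)
    (fun l => nth 0 [:: x + t *: P (e i); x + - t *: P (e i); x'] l) _ p0 cvx _ zN.
  rewrite norm_powR_scale// !big_ord_recl big_ord0/= addr0; apply.
    by case=> [[|[|[|]]]]//= _; rewrite ?invr_ge0// mulr_ge0 ?sqr_ge0// ltW.
  move=> j; rewrite !big_ord_recl big_ord0/= addr0 coord_powR_scale//.
  rewrite !coordD !coordZ x'E mulNr; have [->|jk] := eqVneq j k.
    rewrite normr0 powR0 ?gt_eqF// mulr0 addr0.
    rewrite /rho mulrAC -exprMn [_ * t]mulrC.
    by apply: powR_parallelogram_ge xk; exact: ltW.
  rewrite mulrDl mul1r addrA lerD2r; apply: powR_norm_midpoint.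
  by apply: ltW; apply: lt_trans p2; rewrite ltr1n.
(* Averaging [upper] over t and -t and inserting it in [lower] leaves rho t^2 (|x|^p - |x'|^p) <=
   t^p |e_i|^p. *)
have := upper t (gtr0_norm t0).
have := upper (- t); rewrite normrN gtr0_norm// => /(_ erefl).
by move: lower; rewrite two; lra.
Qed.

Lemma concave_contraction_invariant q N x i k :
  1 <= q < 2 -> one_concave d e q -> P x = x -> supp_below N x ->
  index_set d i -> index_set d k ->
  coord x i = 0 -> coord x k != 0 -> coord (P (e k)) i = 0.
Proof.
move=> /andP[q1 q2] ccv Px xN di dk xi xk; apply: contrapT => /eqP wi.
have q0 : 0 < q by apply: lt_le_trans q1.
have ei0 : 0 < `|e i|.
  rewrite normr_gt0; apply/eqP => ei; have := coord_basis i di.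
  by rewrite ei coord0 eqxx => /eqP; rewrite eq_sym oner_eq0.
(* y is P e_k cut down to the support of x. In particular y_i = 0, so x + s y is disjoint from e_i
   and q-concavity adds the full q-th power of s q_ik e_i. *)
have [y yE] := coord_restrict_ex (P (e k)) xN.
have yN : supp_below N y by move=> j Nj; rewrite yE xN// eqxx.
suff : (`|coord (P (e k)) i| * `|e i|) `^ q <= 0.
  by rewrite leNgt powR_gt0// mulr_gt0// normr_gt0.
apply: (@powR_small_coef R q 2 _ (`|x| `^ q / coord x k ^+ 2)); first by rewrite q0.
move=> t t0; have two : t `^ 2 = t ^+ 2 by rewrite powR_mulrn// ltW.
pose rho := t ^+ 2 / coord x k ^+ 2.
have r1 : 0 <= 1 + rho by rewrite addr_ge0// divr_ge0 ?sqr_ge0.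
have lower (s : R) : `|s| = t -> `|x + s *: y| `^ q +
    (`|coord (P (e k)) i| * `|e i|) `^ q * t `^ q <= `|x + s *: e k| `^ q.
  move=> st; apply: (@le_trans _ _ (`|x + s *: P (e k)| `^ q)); last first.
    by rewrite ge0_ler_powR ?nnegrE ?(ltW q0)// -{1}Px -linearZ -linearD.
  have := @one_concave_ge q (maxn N i.+1) 2
    (fun l => nth 0 [:: 1; (`|coord (P (e k)) i| * t) `^ q] l)
    (fun l => nth 0 [:: x + s *: y; e i] l) (x + s *: P (e k)) q0 ccv.
  rewrite !big_ord_recl big_ord0/= addr0 mul1r.
  rewrite !powRM ?(ltW t0)// mulrAC; apply.
  - by case=> [[|[|]]]//= _; rewrite mulr_ge0 ?powR_ge0.
  - case=> [[|[|]]]//= _.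
      rewrite addrC; apply: supp_belowPZ; exact: supp_belowW (leq_maxl _ _) _.
    exact: supp_belowW (leq_maxr _ _) (supp_below_basis di).
  move=> j; rewrite !big_ord_recl big_ord0/= addr0 mul1r !coordD !coordZ yE.
  rewrite coord_basis//; have [->|_] := eqVneq j i.
    rewrite xi eqxx mulr0 !add0r normr0 powR0 ?gt_eqF// add0r normr1 powR1 mulr1.
    by rewrite normrM st mulrC powRM// ltW.
  rewrite mulr0n normr0 powR0 ?mulr0 ?addr0; last by rewrite gt_eqF.
  have [->|//] := eqVneq (coord x j) 0.
  by rewrite mulr0 add0r normr0 powR0 ?powR_ge0// gt_eqF.
(* Only coordinate k changes with t; there the parallelogram inequality costs the factor 1 + rho,
   and elsewhere 1 <= 1 + rho suffices. *)
have upper : 2^-1 * `|x + t *: e k| `^ q + 2^-1 * `|x + - t *: e k| `^ q <=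
    (1 + rho) * `|x| `^ q.
  have ekN s : supp_below (maxn N k.+1) (x + s *: e k).
    rewrite addrC; apply: supp_belowPZ.
      exact: supp_belowW (leq_maxr _ _) (supp_below_basis dk).
    exact: supp_belowW (leq_maxl _ _) xN.
  have := @one_concave_ge q (maxn N k.+1) 2
    (fun l => nth 0 [:: 2^-1; 2^-1] l)
    (fun l => nth 0 [:: x + t *: e k; x + - t *: e k] l)
    ((1 + rho) `^ q^-1 *: x) q0 ccv.
  rewrite norm_powR_scale// !big_ord_recl big_ord0/= addr0; apply.
  - by case=> [[|[|]]]//= _; rewrite invr_ge0.
  - by case=> [[|[|]]]//=.
  move=> j; rewrite !big_ord_recl big_ord0/= addr0 coord_powR_scale//.
  rewrite !coordD !coordZ coord_basis//; have [->|jk] := eqVneq j k.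
    by rewrite !mulr1; apply: powR_parallelogram_le xk; rewrite q0 ltW.
  rewrite !mulr0 addr0 -mulrDl ler_wpM2r ?powR_ge0//.
  have : 0 <= rho by rewrite divr_ge0 ?sqr_ge0.
  by lra.
(* Averaging [lower] over both signs, the terms in x + t y and x - t y have mean at least |x|^q.
   What remains is of order t^q on the left and t^2 on the right. *)
have := lower t (gtr0_norm t0).
have := lower (- t); rewrite normrN gtr0_norm// => /(_ erefl).
have := powR_norm_midpoint x (t *: y) q1; rewrite -scaleNr.
have -> : `|x| `^ q / coord x k ^+ 2 * t `^ 2 = rho * `|x| `^ q.
  by rewrite two /rho; ring.
by move: upper; lra.
Qed.
End Contraction.
End SequenceSpace.

(** * Codimension and counting *)

Lemma codim_kernel (R : realType) (X : normedModType R)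
    (F : {pred X}) (n N : nat) (u : 'I_N -> X) :
  submod_closed F -> has_codim F n ->
  exists W : 'M[R]_N, (N <= n + \rank W)%N /\
    forall r, \sum_i W r i *: u i \in F.
Proof.
move=> [F0 Flin] [v vP].
have Fsum (I : finType) (a : I -> R) (f : I -> X) :
    (forall i, f i \in F) -> \sum_i a i *: f i \in F.
  move=> fF; elim/big_ind : _ => // [x y xF yF|i _].
    by rewrite -[x]scale1r; apply: Flin.
  by rewrite -[_ *: _]addr0; apply: Flin.
have ex i : exists c : 'rV[R]_n, u i - \sum_(l < n) c ord0 l *: v l \in F.
  by have [c [cF _]] := vP (u i); exists c.
have [c cF] := choice ex.
(* The rows of [M] are the classes of the u_i in the n-dimensional quotient by F. Its left kernel,
   of rank at least N - n, gives combinations lying in F. *)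
pose M : 'M[R]_(N, n) := \matrix_i c i.
exists (kermx M); split.
  by rewrite mxrank_ker -leq_subLR leq_sub2l// rank_leq_col.
move=> r.
have K l : \sum_i kermx M r i * c i ord0 l = 0.
  have /matrixP/(_ r l) := mulmx_ker M; rewrite mxE [RHS]mxE => E; rewrite -[RHS]E.
  by apply: eq_bigr => i _; rewrite [M _ _]mxE.
rewrite (_ : \sum_i _ = \sum_i kermx M r i *: (u i - \sum_(l < n) c i ord0 l *: v l)).
  exact: Fsum.
under [RHS]eq_bigr do rewrite scalerBr.
rewrite sumrB -[LHS]subr0; congr (_ - _); apply/esym.
under eq_bigr do rewrite scaler_sumr.
rewrite exchange_big big1// => l _.
by under eq_bigr do rewrite scalerA; rewrite -scaler_suml K scale0r.
Qed.

Lemma card_le_II_inj (S : set nat) (n : nat) :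
  ~ (S #<= `I_n) -> exists f : 'I_n.+1 -> nat, injective f /\ forall i, S (f i).
Proof.
move=> nS.
have : `I_n.+1 #<= S.
  have [/finite_setP[m Sm]|/infiniteP inf] := pselect (finite_set S).
    rewrite (card_le_eqr Sm) card_le_II ltnNge; apply/negP => mn.
    by apply: nS; rewrite (card_le_eql Sm) card_le_II.
  exact: card_le_trans (card_leT _) inf.
move=> /pcard_leP[f]; exists (fun i => f (val i)); split=> [i j|i].
  by move=> /(@inj _ _ _ f) E; apply: val_inj; apply: E; rewrite inE/=.
by apply: (@funS _ _ _ _ f); rewrite /= ltn_ord.
Qed.

(** The last hypothesis is the common form of the two cases. Vanishing in a single direction is
    enough: it makes one coordinate functional a multiple of the other. *)
Lemma card_nonfixed_basis_le (R : realType) (X : normedModType R) (d : option nat)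
    (e : nat -> X) (F : {pred X}) (P : {linear X -> X}) (n : nat) :
  one_unconditional_basis d e -> strictly_monotone d e ->
  submod_closed F -> has_codim F n ->
  (forall x, P x \in F) -> (forall x, x \in F -> P x = x) ->
  (forall x, `|P x| <= `|x|) ->
  (forall i k, index_set d i -> index_set d k -> coord d e (P (e k)) i != 0 ->
    (forall N x, P x = x -> supp_below d e N x ->
       coord d e x k = 0 -> coord d e x i = 0) \/
    (forall N x, P x = x -> supp_below d e N x ->
       coord d e x i = 0 -> coord d e x k = 0)) ->
  [set i | index_set d i /\ e i \notin F] #<= `I_(2 * n)%N.
Proof.
move=> he hmono hF hcodim PF Pfix P_le sep; apply: contrapT.
move=> /card_le_II_inj[f [f_inj fS]].
have fd i : index_set d (f i) by have [] := fS i.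
have [W [rkW WF]] := codim_kernel (fun i => e (f i)) hF hcodim.
(* [W] has 2n+1 rows, so its rank is at least n+1. *)
suff : (2 * \rank W <= (2 * n).+1)%N by move: rkW; lia.
pose x r := \sum_i W r i *: e (f i).
have Px r : P (x r) = x r by apply: Pfix; exact: WF.
have cx r j : coord d e (x r) (f j) = W r j.
  rewrite coord_sum// (bigD1 j)//= coordZ// coord_basis// eqxx mulr1 big1 ?addr0//.
  move=> l lj; rewrite coordZ// coord_basis// (inj_eq f_inj) eq_sym (negPf lj).
  by rewrite mulr0.
pose N := \max_i (f i).+1.
have xN r : supp_below d e N (x r).
  move=> j Nj; rewrite coord_sum// big1// => l _; rewrite coordZ// coord_basis//.
  rewrite gtn_eqF ?mulr0//; apply: leq_trans Nj.
  exact: (@leq_bigmax _ (fun i => (f i).+1) l).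
pose Q i k := coord d e (P (e (f k))) (f i).
have WQ r i : W r i = \sum_k W r k * Q i k.
  rewrite -{1}cx -Px /x linear_sum/= coord_sum//.
  by apply: eq_bigr => l _; rewrite linearZ/= coordZ.
have Q1 i : Q i i != 1.
  apply/eqP => Qi; have [_ /negP] := fS i; apply.
  by rewrite -(contraction_fixes_basis he hmono P_le (fd i) Qi).
(* After transposition, the rows are the coordinates f i evaluated on the spanning vectors [x r]. *)
rewrite -mxrank_tr; apply: rank_le_half_of_parallel => i /rV0Pn[r].
rewrite !mxE => Wri.
(* W r i (1 - Q i i) is nonzero and equals the sum of W r k Q i k over k != i, so some term is
   nonzero. *)
have [k ik WQk] : exists2 k, i != k & W r k * Q i k != 0.
  apply: contrapT => nex; have := WQ r i; rewrite (bigD1 i)//= big1 ?addr0.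
    move=> /eqP; rewrite -subr_eq0 -{1}[W r i]mulr1 -mulrBr mulf_eq0 (negPf Wri)/=.
    by rewrite subr_eq0 eq_sym (negPf (Q1 i)).
  by move=> k ki; apply: contrapT => /eqP h; apply: nex; exists k; rewrite // eq_sym.
move: WQk; rewrite mulf_eq0 negb_or => /andP[Wrk Qik].
exists k; split=> //; exists (W r i / W r k); apply/rowP => s; rewrite !mxE.
(* Combinations of [x s] and [x r], with coefficients chosen below to cancel one of the two
   coordinates; the other must then vanish too, which is the proportionality. *)
pose y (c c' : R) := c *: x s + c' *: x r.
have Py c c' : P (y c c') = y c c' by rewrite linearD !linearZ/= !Px.
have yN c c' : supp_below d e N (y c c').
  by move=> j Nj; rewrite coordPZ// coordZ// !xN// !mulr0 addr0.
have cy c c' j : coord d e (y c c') (f j) = c * W s j + c' * W r j.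
  by rewrite coordPZ// coordZ// !cx.
suff E : W r k * W s i = W r i * W s k.
  by apply: (mulfI Wrk); rewrite E; field.
have [h|h] := sep _ _ (fd i) (fd k) Qik.
- have E : coord d e (y (W r k) (- W s k)) (f k) = 0 by rewrite cy; ring.
  by have := h _ _ (Py _ _) (yN _ _) E; rewrite cy; lra.
- have E : coord d e (y (W r i) (- W s i)) (f i) = 0 by rewrite cy; ring.
  by have := h _ _ (Py _ _) (yN _ _) E; rewrite cy; lra.
Qed.

Theorem theorem1 (R : realType) (X : completeNormedModType R)
    (d : option nat) (e : nat -> X)
    (hd : forall m, d = Some m -> (3 <= m)%N)
    (he : one_unconditional_basis d e)
    (hmono : strictly_monotone d e)
    (hX : (exists2 p : R, 2 < p & one_convex d e p) \/
          ((exists2 q : R, 1 < q < 2 & one_concave d e q) /\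
           (forall i, index_set d i -> smooth_at (e i))))
    (F : {pred X}) (n : nat)
    (hF : submod_closed F)
    (hcodim : has_codim F n)
    (hcompl : one_complemented F) :
  [set i | index_set d i /\ e i \notin F] #<= `I_(2 * n)%N.
Proof.
have [P [PF Pfix P_le]] := hcompl.
apply: (@card_nonfixed_basis_le _ _ _ _ _ P) => // i k di dk Qik.
case: hX => [[p p2 cvx]|[[q /andP[q1 q2] ccv] _]].
(* The disjointness lemma is applied with i and k exchanged: e_k is projected and x_k = 0. *)
- left=> N x Px xN xk; apply/eqP/negPn/negP => xi; move: Qik.
  by rewrite (convex_contraction_disjoint he hmono P_le p2 cvx Px xN dk xk xi) eqxx.
- right=> N x Px xN xi; apply/eqP/negPn/negP => xk; move: Qik.
  have q12 : 1 <= q < 2 by rewrite ltW.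
  by rewrite (concave_contraction_invariant he hmono P_le q12 ccv Px xN
    di dk xi xk) eqxx.
Qed.
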